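(* Consider the double sweep optimized Schwarz method (DOSM, at the matrix level, defined in the context) for the linear system $A\mathbf u=\mathbf f$. Suppose that in both the forward and the backward sweeps, for $j=2,\dots,J$, $Q_j^{l}=I$ and $$P_j^{l}=A_{l_j}^{\mathrm{ext}}-A[l_j,X_j]\,A[X_j,X_j]^{-1}A[X_j,l_j]$$ is well-defined (i.e. $A[X_j,X_j]$ is invertible), and suppose that the original system and all the subdomain problems of the DOSM are uniquely solvable. Then the DOSM converges in one step, i.e. $\mathbf u_j^{(1)}=\mathbf u[W_j]$ for $j=1,\dots,J$, where $\mathbf u$ is the solution of $A\mathbf u=\mathbf f$. That is, the iteration matrix of the DOSM (mapping the errors $(\mathbf u[W_j]-\mathbf u_j^{(n-1)})_j$ to $(\mathbf u[W_j]-\mathbf u_j^{(n)})_j$) is nilpotent of degree one.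
   Context: For index sets $X,Y$, $A[X,Y]$ is the submatrix with rows $X$ and columns $Y$, and $\mathbf v[X]$ is the restriction of a vector $\mathbf v$ to $X$; $A$ is a complex square matrix. Index sets. The global index set is the disjoint union of sets $\Theta_1,V_1,\Theta_2,V_2,\dots,V_{J-1},\Theta_J$ with all $\Theta_j\ne\emptyset$ ($\Theta_j$: unknowns only in subdomain $j$; $V_j$: unknowns in the closed overlap of subdomains $j$ and $j+1$), and $A$ is block tridiagonal for this ordering. Either the decomposition is non-overlapping, in which case $E_j=F_j=V_j$; or $V_j$ is a disjoint union $E_j\cup V_j^\circ\cup F_j$, where $E_j$ are the unknowns on the interface $\Gamma_{j+1,j}$ (left end of the overlap) and $F_j$ those on $\Gamma_{j,j+1}$ (right end), and there is no direct interaction across the interfaces: the blocks of $A$ coupling $\Theta_j$ with $V_j^\circ\cup F_j$ and those coupling $\Theta_{j+1}$ with $E_j\cup V_j^\circ$ vanish (in both row/column orders). Subdomain $j$ has unknowns $W_j=V_{j-1}\cup\Theta_j\cup V_j$, left interface $l_j:=E_{j-1}$, right interface $r_j:=F_j$, and interior $N_j:=W_j\setminus(l_j\cup r_j)$. Set $X_j:=\Theta_1\cup V_1\cup\dots\cup V_{j-2}\cup\Theta_{j-1}$ (everything to the left of subdomain $j$). Sets with out-of-range index ($l_1$, $r_J$, $V_0$, $V_J$) are empty and the corresponding rows/columns are deleted. Splittings. $A[l_j,l_j]=A_{l_j}^{\mathrm{int}}+A_{l_j}^{\mathrm{ext}}$ and $A[r_j,r_j]=A_{r_j}^{\mathrm{int}}+A_{r_j}^{\mathrm{ext}}$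 are given splittings into the contributions from the side of the interface on which subdomain $j$ lies (int) and from the other side (ext). DOSM (matrix level). $Q_j^l,P_j^l$ (on $l_j$) and $Q_j^r,P_j^r$ (on $r_j$) are given square matrices. Given $\{\mathbf u_j^{(n-1)}\in\mathbb C^{W_j}\}_{j=1}^J$ (arbitrary for $n=1$), the forward sweep solves successively for $j=1,\dots,J-1$ for $\mathbf u_j=\mathbf u_j^{(n-1/2)}\in\mathbb C^{W_j}$, with $\mathbf a=\mathbf u_{j-1}^{(n-1/2)}$ and $\mathbf b=\mathbf u_{j+1}^{(n-1)}$: $$(Q_j^lA_{l_j}^{\mathrm{int}}+P_j^l)\mathbf u_j[l_j]+Q_j^lA[l_j,N_j]\mathbf u_j[N_j]=Q_j^l\big(\mathbf f[l_j]-A[l_j,\Theta_{j-1}]\mathbf a[\Theta_{j-1}]\big)+(P_j^l-Q_j^lA_{l_j}^{\mathrm{ext}})\mathbf a[l_j],$$ $$A[N_j,W_j]\mathbf u_j=\mathbf f[N_j],$$ $$Q_j^rA[r_j,N_j]\mathbf u_j[N_j]+(Q_j^rA_{r_j}^{\mathrm{int}}+P_j^r)\mathbf u_j[r_j]=Q_j^r\big(\mathbf f[r_j]-A[r_j,\Theta_{j+1}]\mathbf b[\Theta_{j+1}]\big)+(P_j^r-Q_j^rA_{r_j}^{\mathrm{ext}})\mathbf b[r_j].$$ The backward sweep solves successively for $j=J,\dots,1$ the same system for $\mathbf u_j=\mathbf u_j^{(n)}$ with $\mathbf a=\mathbf u_{j-1}^{(n-1/2)}$ and $\mathbf b=\mathbf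 u_{j+1}^{(n)}$. *)

(* Defs.v *)
From HB Require Import structures.
From mathcomp Require Import all_boot all_order all_algebra.
From mathcomp Require Import complex.
From mathcomp Require Import reals.

Set Implicit Arguments.
Unset Strict Implicit.
Unset Printing Implicit Defensive.

Import GRing.Theory.
Local Open Scope ring_scope.

Section Restriction.
Variables (K : fieldType) (n : nat).

(* A[X, Y]; the rows and columns are listed in the order of [enum X], [enum Y],
   and an empty index set gives a matrix with no rows or no columns. *)
Definition blk (A : 'M[K]_n) (X Y : {set 'I_n}) : 'M[K]_(#|X|, #|Y|) :=
  \matrix_(i, j) A (enum_val i) (enum_val j).

(* v[X] for a global vector v *)
Definition vrestr (v : 'cV[K]_n) (X : {set 'I_n}) : 'cV[K]_#|X| :=
  \col_i v (enum_val i) 0.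

(* v[Y] for a vector v indexed by X, used for Y \subset X only: the rows of
   the selection matrix I[Y, X] pick the entries of v lying in Y. *)
Definition lrestr (X : {set 'I_n}) (v : 'cV[K]_#|X|) (Y : {set 'I_n}) :
  'cV[K]_#|Y| := blk 1%:M Y X *m v.

End Restriction.

(* Subdomains are numbered from 1 to [nsub], as in Theta_1, V_1, ..., Theta_J;
   [wf_decomposition] makes every set with an out-of-range index empty. *)
Record decomposition (n : nat) := Decomposition {
  nsub : nat;
  Theta : nat -> {set 'I_n};
  V : nat -> {set 'I_n};
  E : nat -> {set 'I_n};
  F : nat -> {set 'I_n}
}.

Section IndexSets.
Variables (n : nat) (D : decomposition n).

Definition W (j : nat) : {set 'I_n} := V D j.-1 :|: Theta D j :|: V D j.
Definition lset (j : nat) : {set 'I_n} := E D j.-1.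
Definition rset (j : nat) : {set 'I_n} := F D j.
Definition N (j : nat) : {set 'I_n} := W j :\: (lset j :|: rset j).

(* Theta_1, V_1, ..., V_(j-2), Theta_(j-1) *)
Definition X (j : nat) : {set 'I_n} :=
  (\bigcup_(1 <= i < j) Theta D i) :|: (\bigcup_(1 <= i < j.-1) V D i).

(* The k-th set, for 1 <= k <= 2J - 1, of the list Theta_1, V_1, ..., Theta_J:
   Theta_j has position 2j - 1 and V_j has position 2j. *)
Definition block (k : nat) : {set 'I_n} :=
  if odd k then Theta D (uphalf k) else V D k./2.

End IndexSets.

Section WellFormed.
Variables (K : fieldType) (n : nat).
Implicit Types (A : 'M[K]_n) (D : decomposition n).

Definition uncoupled A (Y Z : {set 'I_n}) : Prop :=
  blk A Y Z = 0 /\ blk A Z Y = 0.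

Definition nonoverlapping D : Prop :=
  forall j, (0 < j < nsub D)%N -> E D j = V D j /\ F D j = V D j.

Definition overlapping A D : Prop :=
  forall j, (0 < j < nsub D)%N -> exists Vo : {set 'I_n},
    [/\ V D j = E D j :|: Vo :|: F D j,
        [/\ [disjoint E D j & Vo], [disjoint Vo & F D j]
          & [disjoint E D j & F D j]],
        uncoupled A (Theta D j) (Vo :|: F D j)
      & uncoupled A (Theta D j.+1) (E D j :|: Vo)].

Record wf_decomposition A D : Prop := WfDecomposition {
  wf_nsub : (0 < nsub D)%N;
  wf_Theta : forall j, (0 < j <= nsub D)%N -> Theta D j != set0;
  wf_Theta_out : forall j, ~~ (0 < j <= nsub D)%N -> Theta D j = set0;
  wf_V_out : forall j, ~~ (0 < j < nsub D)%N ->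
    [/\ V D j = set0, E D j = set0 & F D j = set0];
  wf_disjoint : forall a b, a != b -> [disjoint block D a & block D b];
  wf_cover : \bigcup_(1 <= k < (nsub D).*2) block D k = [set: 'I_n];
  wf_tridiagonal : forall a b, (a.+1 < b)%N ->
    uncoupled A (block D a) (block D b);
  wf_interfaces : nonoverlapping D \/ overlapping A D
}.

End WellFormed.

Section DOSM.
Variables (K : fieldType) (n : nat) (A : 'M[K]_n) (D : decomposition n).

Record splitting := Splitting {
  Al_int : forall j, 'M[K]_#|lset D j|;
  Al_ext : forall j, 'M[K]_#|lset D j|;
  Ar_int : forall j, 'M[K]_#|rset D j|;
  Ar_ext : forall j, 'M[K]_#|rset D j|
}.

Definition is_splitting (S : splitting) : Prop :=
  forall j, (0 < j <= nsub D)%N ->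
    blk A (lset D j) (lset D j) = Al_int S j + Al_ext S j /\
    blk A (rset D j) (rset D j) = Ar_int S j + Ar_ext S j.

Record transmission := Transmission {
  Ql : forall j, 'M[K]_#|lset D j|;
  Pl : forall j, 'M[K]_#|lset D j|;
  Qr : forall j, 'M[K]_#|rset D j|;
  Pr : forall j, 'M[K]_#|rset D j|
}.

Definition locals := forall j, 'cV[K]_#|W D j|.

Variable S : splitting.

Definition subproblem (T : transmission) (f : 'cV[K]_n) (j : nat)
    (a : 'cV[K]_#|W D j.-1|) (b : 'cV[K]_#|W D j.+1|)
    (uj : 'cV[K]_#|W D j|) : Prop :=
  let l := lset D j in let r := rset D j in let Nj := N D j in
  [/\ (Ql T j *m Al_int S j + Pl T j) *m lrestr uj l
        + Ql T j *m blk A l Nj *m lrestr uj Nj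
      = Ql T j *m (vrestr f l
                   - blk A l (Theta D j.-1) *m lrestr a (Theta D j.-1))
        + (Pl T j - Ql T j *m Al_ext S j) *m lrestr a l,
      blk A Nj (W D j) *m uj = vrestr f Nj
    & Qr T j *m blk A r Nj *m lrestr uj Nj
        + (Qr T j *m Ar_int S j + Pr T j) *m lrestr uj r
      = Qr T j *m (vrestr f r
                   - blk A r (Theta D j.+1) *m lrestr b (Theta D j.+1))
        + (Pr T j - Qr T j *m Ar_ext S j) *m lrestr b r].

Definition uniquely_solvable_subproblem T f (j : nat) : Prop :=
  forall a b, exists! uj, @subproblem T f j a b uj.

(* [Tf] and [Tb] are the transmission matrices of the forward and of the
   backward sweep; they may coincide. *)
Variables (Tf Tb : transmission) (f : 'cV[K]_n).

Definition forward_sweep (uold uhalf : locals) : Prop :=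
  forall j, (0 < j < nsub D)%N ->
    subproblem Tf f (uhalf j.-1) (uold j.+1) (uhalf j).

Definition backward_sweep (uhalf unew : locals) : Prop :=
  forall j, (0 < j <= nsub D)%N ->
    subproblem Tb f (uhalf j.-1) (unew j.+1) (unew j).

Definition dosm_step (uold unew : locals) : Prop :=
  exists uhalf, forward_sweep uold uhalf /\ backward_sweep uhalf unew.

Definition dosm (us : nat -> locals) : Prop :=
  forall m, dosm_step (us m) (us m.+1).

(* (u[W_j] - v_j)_(1 <= j <= J), stacked *)
Definition error (u : 'cV[K]_n) (v : locals) :
    'cV[K]_(\sum_(j < nsub D) #|W D j.+1|) :=
  \mxcol_(j < nsub D) (vrestr u (W D j.+1) - v j.+1).

Definition is_iteration_matrix (u : 'cV[K]_n)
    (M : 'M[K]_(\sum_(j < nsub D) #|W D j.+1|)) : Prop :=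
  forall uold unew, dosm_step uold unew ->
    error u unew = M *m error u uold.

Definition exact_left (T : transmission) : Prop :=
  forall j, (1 < j <= nsub D)%N ->
    let l := lset D j in let Xj := X D j in
    [/\ blk A Xj Xj \in unitmx,
        Ql T j = 1%:M
      & Pl T j = Al_ext S j
                 - blk A l Xj *m invmx (blk A Xj Xj) *m blk A Xj l].

End DOSM.

Definition nilpotent_of_degree (K : fieldType) (m : nat) (M : 'M[K]_m)
    (d : nat) : Prop :=
  M ^+ d = 0 /\ forall k, (k < d)%N -> M ^+ k != 0.

(* Main.v *)
(* Let e_j be the error of the forward sweep on W_j. With Q_j^l = I and the Schur
   complement P_j^l, the left condition on e_j depends on e_(j-1) only through
     A[l_j, Theta_(j-1)] e_(j-1)[Theta_(j-1)]
       + A[l_j, X_j] A[X_j, X_j]^-1 A[X_j, l_j] e_(j-1)[l_j],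
   the left residual. If it vanishes, extend e_j to X_j by
   - A[X_j, X_j]^-1 A[X_j, l_j] e_j[l_j]: the extension z satisfies (A z)[i] = 0
   for all i in X_(j+1), so eliminating X_(j+1) shows that the left residual of
   e_j vanishes as well. Hence after the forward sweep all the left data are
   exact, whatever the right data were; going back from j = J, where there is no
   right interface, unique solvability makes each subdomain solution exact. *)
Require Import Defs.
From HB Require Import structures.
From mathcomp Require Import all_boot all_order all_algebra.
From mathcomp Require Import complex.
From mathcomp Require Import reals.
From mathcomp Require Import boolp zify.

Set Implicit Arguments.
Unset Strict Implicit.
Unset Printing Implicit Defensive.

Import GRing.Theory.
Local Open Scope ring_scope.

(** * Restrictions of global vectors and block products *)

Section Restriction.
Variables (K : fieldType) (n : nat).
Implicit Types (A : 'M[K]_n) (X Y Z : {set 'I_n}) (v w : 'cV[K]_n).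

(** Extension by zero: it turns [A[Y,Z] w[Z]] into a restriction of [A *m mask Z w], so products
    over different index sets can be compared entry by entry. *)
Definition mask Z w : 'cV[K]_n := \col_k (w k 0 *+ (k \in Z)).

Lemma maskE Z w k : mask Z w k 0 = w k 0 *+ (k \in Z).
Proof. exact: mxE. Qed.

Lemma vrestr_surj X (x : 'cV[K]_#|X|) : exists w, x = vrestr w X.
Proof.
exists (\col_i \sum_(k | enum_val k == i) x k 0).
apply/colP => i; rewrite !mxE (big_pred1 i) // => k.
by rewrite /= (inj_eq enum_val_inj).
Qed.

Lemma eq_vrestr X v w :
  {in X, forall i, v i 0 = w i 0} -> vrestr v X = vrestr w X.
Proof. by move=> h; apply/colP => i; rewrite !mxE h // enum_valP. Qed.

Lemma vrestr_inj_in X v w :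
  vrestr v X = vrestr w X -> {in X, forall i, v i 0 = w i 0}.
Proof.
move=> h i Xi; move/colP/(_ (enum_rank_in Xi i)): h.
by rewrite !mxE enum_rankK_in.
Qed.

Lemma vrestrD X v w : vrestr (v + w) X = vrestr v X + vrestr w X.
Proof. by apply/colP => i; rewrite !mxE. Qed.

Lemma vrestr0 X : vrestr 0 X = 0 :> 'cV[K]_#|X|.
Proof. by apply/colP => i; rewrite !mxE. Qed.

Lemma blk_vrestr A Y Z w :
  blk A Y Z *m vrestr w Z = vrestr (A *m mask Z w) Y.
Proof.
apply/colP => i; rewrite !mxE.
under eq_bigr => k _ do rewrite !mxE.
rewrite -(big_enum_val (fun k => A (enum_val i) k * w k 0)) big_mkcond /=.
by apply: eq_bigr => k _; rewrite !mxE; case: ifP => _; rewrite ?mulr0.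
Qed.

Lemma lrestr_vrestr X Y w :
  Y \subset X -> lrestr (vrestr w X) Y = vrestr w Y.
Proof.
move=> /subsetP sYX; rewrite /lrestr blk_vrestr mul1mx.
by apply: eq_vrestr => i /sYX Xi; rewrite mxE Xi.
Qed.

Lemma lrestrB X Y (x y : 'cV[K]_#|X|) :
  lrestr (x - y) Y = lrestr x Y - lrestr y Y.
Proof. exact: mulmxBr. Qed.

Lemma eq_mulmx_coupled A i v w :
  (forall k, A i k != 0 -> v k 0 = w k 0) -> (A *m v) i 0 = (A *m w) i 0.
Proof.
move=> h; rewrite !mxE; apply: eq_bigr => k _.
by have [->|/h->//] := eqVneq (A i k) 0; rewrite !mul0r.
Qed.

End Restriction.

Lemma in_bigcup_nat n (G : nat -> {set 'I_n}) a b i :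
  reflect (exists2 c, (a <= c < b)%N & i \in G c)
          (i \in \bigcup_(a <= c < b) G c).
Proof.
rewrite big_nat; apply: (iffP idP) => [|[c hc Gi]].
  apply: (big_ind (fun Y : {set 'I_n} =>
    i \in Y -> exists2 c, (a <= c < b)%N & i \in G c)) => [|Y Z hY hZ|c hc Gi].
  - by rewrite inE.
  - by rewrite inE => /orP[].
  - by exists c.
rewrite -big_nat (@big_cat_nat _ _ _ c) /=; try lia.
rewrite [X in _ :|: X]big_ltn; last lia.
by rewrite !inE Gi orbT.
Qed.

(** * Block positions and the couplings they exclude *)

Section Positions.
Variables (K : fieldType) (n : nat) (A : 'M[K]_n) (D : decomposition n).
Hypothesis hD : wf_decomposition A D.

Lemma position_exists :
  exists pos : 'I_n -> nat, forall i b, (i \in block D b) = (pos i == b).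
Proof.
have ex (i : 'I_n) : exists b, i \in block D b.
  have : i \in [set: 'I_n] by rewrite inE.
  by rewrite -(wf_cover hD) => /in_bigcup_nat[b _ hb]; exists b.
have [pos hpos] := fin_all_exists ex.
exists pos => i b; apply/idP/eqP => [ib|<-//]; apply/eqP.
apply/negPn/negP => /(wf_disjoint hD) /disjoint_setI0 /setP /(_ i).
by rewrite !inE hpos ib.
Qed.

Lemma subset_EV j : E D j \subset V D j.
Proof.
case: (boolP (0 < j < nsub D)%N) => hj; last first.
  by have [_ -> _] := wf_V_out hD hj; apply: sub0set.
case: (wf_interfaces hD) => [/(_ j hj)[->]//|/(_ j hj)[Vo [-> _ _ _]]].
by rewrite -setUA subsetUl.
Qed.

Lemma subset_FV j : F D j \subset V D j.
Proof.
case: (boolP (0 < j < nsub D)%N) => hj; last first.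
  by have [_ _ ->] := wf_V_out hD hj; apply: sub0set.
case: (wf_interfaces hD) => [/(_ j hj)[_ ->]//|/(_ j hj)[Vo [-> _ _ _]]].
by rewrite subsetUr.
Qed.

Lemma uncoupled_entry (Y Z : {set 'I_n}) i k :
  uncoupled A Y Z -> i \in Y -> k \in Z -> A i k = 0 /\ A k i = 0.
Proof.
move=> [/matrixP hYZ /matrixP hZY] Yi Zk; split.
  move/(_ (enum_rank_in Yi i) (enum_rank_in Zk k)): hYZ.
  by rewrite !mxE !enum_rankK_in.
move/(_ (enum_rank_in Zk k) (enum_rank_in Yi i)): hZY.
by rewrite !mxE !enum_rankK_in.
Qed.

(** Without overlap [E_j = V_j], so the premises on [k] are contradictory; with overlap [k] lies in
    [Vo :|: F D j]. *)
Lemma uncoupled_Theta_right j i k :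
  i \in Theta D j -> k \in V D j -> k \notin E D j -> A i k = 0 /\ A k i = 0.
Proof.
move=> Ti Vk; case: (boolP (0 < j < nsub D)%N) => hj; last first.
  by have [V0 _ _] := wf_V_out hD hj; move: Vk; rewrite V0 inE.
case: (wf_interfaces hD) => [/(_ j hj)[-> _]|/(_ j hj)[Vo [eV _ unc _]] nEk].
  by rewrite Vk.
apply: uncoupled_entry unc Ti _.
by move: Vk; rewrite eV !inE (negPf nEk).
Qed.

Lemma uncoupled_Theta_left j i k :
  i \in Theta D j.+1 -> k \in V D j -> k \notin F D j ->
  A i k = 0 /\ A k i = 0.
Proof.
move=> Ti Vk; case: (boolP (0 < j < nsub D)%N) => hj; last first.
  by have [V0 _ _] := wf_V_out hD hj; move: Vk; rewrite V0 inE.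
case: (wf_interfaces hD) => [/(_ j hj)[_ ->]|/(_ j hj)[Vo [eV _ _ unc]] nFk].
  by rewrite Vk.
apply: uncoupled_entry unc Ti _.
by move: Vk; rewrite eV !inE (negPf nFk) orbF.
Qed.

(* [pos i] is the rank, in Theta_1, V_1, ..., Theta_J, of the set containing i;
   it reduces all set-theoretic facts to arithmetic on block numbers. *)
Section WithPosition.
Variable pos : 'I_n -> nat.
Hypothesis posP : forall i b, (i \in block D b) = (pos i == b).

Lemma in_V i j : (i \in V D j) = (pos i == j.*2).
Proof. by rewrite -posP /block odd_double doubleK. Qed.

Lemma in_Theta i j : (i \in Theta D j) = ((pos i).+1 == j.*2).
Proof.
case: j => [|j]; first by rewrite (wf_Theta_out hD) // inE.
by rewrite doubleS eqSS -posP /block /= odd_double /= doubleK.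
Qed.

Lemma in_E i j : i \in E D j -> pos i = j.*2.
Proof. by move/(subsetP (subset_EV j)); rewrite in_V => /eqP. Qed.

Lemma in_F i j : i \in F D j -> pos i = j.*2.
Proof. by move/(subsetP (subset_FV j)); rewrite in_V => /eqP. Qed.

Lemma in_W i j : (0 < j)%N ->
  (i \in W D j) = (j.-1.*2 <= pos i <= j.*2)%N.
Proof. by rewrite !inE !in_V in_Theta; lia. Qed.

Lemma pos_gt0 i : (0 < pos i)%N.
Proof.
rewrite lt0n; apply/negP => p0; have : i \in V D 0 by rewrite in_V.
by have [] := wf_V_out hD (j := 0) isT => -> _ _; rewrite inE.
Qed.

(** The last block of [X_j] is [Theta_(j-1)], at position [2j - 3]. *)
Lemma in_X i j : (i \in X D j) = ((pos i).+2 < j.*2)%N.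
Proof.
have p0 := pos_gt0 i.
rewrite inE; apply/orP/idP => [[]/in_bigcup_nat[c hc]|h].
- by rewrite in_Theta; lia.
- by rewrite in_V; lia.
case: (boolP (odd (pos i))) => op; [left|right]; apply/in_bigcup_nat.
  by exists (uphalf (pos i)); rewrite ?in_Theta; lia.
by exists (pos i)./2; rewrite ?in_V; lia.
Qed.

Lemma coupled_pos i k : A i k != 0 ->
  (pos i <= (pos k).+1)%N && (pos k <= (pos i).+1)%N.
Proof.
move=> nz; apply: contraNT nz => far.
have hi : i \in block D (pos i) by rewrite posP.
have hk : k \in block D (pos k) by rewrite posP.
have [lt|lt] : ((pos i).+1 < pos k)%N \/ ((pos k).+1 < pos i)%N by lia.
  by have [->] := uncoupled_entry (wf_tridiagonal hD lt) hi hk.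
by have [_ ->] := uncoupled_entry (wf_tridiagonal hD lt) hk hi.
Qed.

Lemma coupled_E i k j : A i k != 0 \/ A k i != 0 ->
  (pos i).+1 = j.*2 -> pos k = j.*2 -> k \in E D j.
Proof.
move=> nz pi pk; apply/negPn/negP => nE.
have [||h1 h2] := @uncoupled_Theta_right j i k _ _ nE.
- by rewrite in_Theta pi.
- by rewrite in_V pk.
by case: nz => /eqP.
Qed.

Lemma coupled_F i k j : A i k != 0 \/ A k i != 0 ->
  pos i = j.*2.+1 -> pos k = j.*2 -> k \in F D j.
Proof.
move=> nz pi pk; apply/negPn/negP => nF.
have [||h1 h2] := @uncoupled_Theta_left j i k _ _ nF.
- by rewrite in_Theta pi doubleS.
- by rewrite in_V pk.
by case: nz => /eqP.
Qed.

Lemma in_N i j : (0 < j)%N ->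
  (i \in N D j) =
  [&& i \notin E D j.-1, i \notin F D j & (j.-1.*2 <= pos i <= j.*2)%N].
Proof. by move=> j0; rewrite in_setD in_setU negb_or -andbA (in_W _ j0). Qed.

Lemma lset_sub_W j : lset D j \subset W D j.
Proof.
apply: subset_trans (subset_EV _) _.
by rewrite /W -setUA subsetUl.
Qed.

Lemma lset_sub_W_pred j : lset D j \subset W D j.-1.
Proof. exact: subset_trans (subset_EV _) (subsetUr _ _). Qed.

Lemma rset_sub_W j : rset D j \subset W D j.
Proof. exact: subset_trans (subset_FV _) (subsetUr _ _). Qed.

Lemma rset_sub_W_succ j : rset D j \subset W D j.+1.
Proof.
apply: subset_trans (subset_FV _) _.
by rewrite /W -setUA subsetUl.
Qed.

Lemma Theta_sub_W j : Theta D j \subset W D j.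
Proof. by rewrite /W setUAC subsetUr. Qed.

Lemma N_sub_W j : N D j \subset W D j.
Proof. exact: subsetDl. Qed.

(** * Rows of the matrix on interfaces and interiors *)

Lemma lset_row j w : (0 < j)%N ->
  vrestr (A *m w) (lset D j) =
    blk A (lset D j) (lset D j) *m vrestr w (lset D j)
    + blk A (lset D j) (N D j) *m vrestr w (N D j)
    + blk A (lset D j) (Theta D j.-1) *m vrestr w (Theta D j.-1).
Proof.
move=> j0; rewrite !blk_vrestr -!vrestrD -!mulmxDr.
apply: eq_vrestr => i Ei; apply: eq_mulmx_coupled => k Aik.
have pi := in_E Ei; have := coupled_pos Aik.
rewrite !mxE -!mulrnDr in_N // in_Theta pi => cp.
have eE : k \in E D j.-1 -> pos k = j.-1.*2 by apply: in_E.
have eF : k \in F D j -> pos k = j.*2 by apply: in_F.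
(* A row of [l_j] reaches only positions [2j - 3] to [2j - 1], where each index lies in exactly one
   of [l_j], [N_j], [Theta_(j-1)]: the three multiplicities add up to 1. *)
rewrite (_ : (_ + _ + _)%N = 1%N) //.
rewrite /lset; case: (k \in E D j.-1) eE => [/(_ isT)|_];
  case: (k \in F D j) eF => [/(_ isT)|_]; lia.
Qed.

Lemma rset_row j w : (0 < j)%N ->
  vrestr (A *m w) (rset D j) =
    blk A (rset D j) (N D j) *m vrestr w (N D j)
    + blk A (rset D j) (rset D j) *m vrestr w (rset D j)
    + blk A (rset D j) (Theta D j.+1) *m vrestr w (Theta D j.+1).
Proof.
move=> j0; rewrite !blk_vrestr -!vrestrD -!mulmxDr.
apply: eq_vrestr => i Fi; apply: eq_mulmx_coupled => k Aik.
have pi := in_F Fi; have := coupled_pos Aik.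
rewrite !mxE -!mulrnDr in_N // in_Theta pi => cp.
have eE : k \in E D j.-1 -> pos k = j.-1.*2 by apply: in_E.
have eF : k \in F D j -> pos k = j.*2 by apply: in_F.
rewrite (_ : (_ + _ + _)%N = 1%N) //.
rewrite /rset; case: (k \in E D j.-1) eE => [/(_ isT)|_];
  case: (k \in F D j) eF => [/(_ isT)|_]; lia.
Qed.

(** Leaving [W_j] would mean stepping from [V_(j-1)] to [Theta_(j-1)] or from [V_j] to
    [Theta_(j+1)], which only interface indices can do. *)
Lemma coupled_N j i k : (0 < j)%N -> i \in N D j -> A i k != 0 -> k \in W D j.
Proof.
move=> j0; rewrite in_N // in_W // => /and3P[nE nF /andP[h1 h2]] Aik.
have := coupled_pos Aik => cp.
apply/negPn/negP => h3.
have [[h4 h5]|[h4 h5]] : (pos i = j.-1.*2 /\ (pos k).+1 = j.-1.*2) \/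
  (pos i = j.*2 /\ pos k = j.*2.+1) by lia.
  by rewrite (coupled_E (or_intror Aik) h5 h4) in nE.
by rewrite (coupled_F (or_intror Aik) h5 h4) in nF.
Qed.

Lemma N_row j w : (0 < j)%N ->
  vrestr (A *m w) (N D j) = blk A (N D j) (W D j) *m vrestr w (W D j).
Proof.
move=> j0; rewrite blk_vrestr; apply: eq_vrestr => i Ni.
by apply: eq_mulmx_coupled => k Aik; rewrite mxE (coupled_N j0 Ni Aik).
Qed.

(** * Propagation of a vanishing left residual *)

Definition left_residual j (a : 'cV[K]_#|W D j.-1|) : 'cV[K]_#|lset D j| :=
  blk A (lset D j) (Theta D j.-1) *m lrestr a (Theta D j.-1)
  + blk A (lset D j) (X D j) *m invmx (blk A (X D j) (X D j))
      *m blk A (X D j) (lset D j) *m lrestr a (lset D j).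

Lemma left_residualB j a b :
  left_residual (a - b) = left_residual a - left_residual b :> 'cV_#|lset D j|.
Proof. by rewrite /left_residual !lrestrB !mulmxBr opprD addrACA. Qed.

(** Induction step of the forward sweep, for an error [e] with homogeneous left and interior
    equations. The index [j.+1.-1] places the final residual on [l_(j+1)]. *)
Lemma left_residual_eq0 j (e : 'cV[K]_n) : (0 < j)%N ->
  blk A (X D j) (X D j) \in unitmx ->
  blk A (X D j.+1) (X D j.+1) \in unitmx ->
  (blk A (lset D j) (lset D j)
   - blk A (lset D j) (X D j) *m invmx (blk A (X D j) (X D j))
       *m blk A (X D j) (lset D j)) *m vrestr e (lset D j)
    + blk A (lset D j) (N D j) *m vrestr e (N D j) = 0 ->
  blk A (N D j) (W D j) *m vrestr e (W D j) = 0 ->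
  left_residual (vrestr e (W D j) : 'cV_#|W D j.+1.-1|) = 0.
Proof.
move=> j0 uX uX' eq_l eq_N.
have [w hw] := vrestr_surj
  (- (invmx (blk A (X D j) (X D j))
      *m (blk A (X D j) (lset D j) *m vrestr e (lset D j)))).
pose z := mask (X D j) w + mask (W D j) e.
(* The masks do not overlap: [X_j] ends at position [2j - 3], [W_j] starts at [2j - 2]. *)
have zE k : z k 0 = if k \in X D j then w k 0 else e k 0 *+ (k \in W D j).
  rewrite !mxE; case: ifP => Xk; last by rewrite add0r.
  rewrite in_W // (_ : (_ <= _ <= _)%N = false) ?addr0 //.
  by move: Xk; rewrite in_X; lia.
(* Outside [X_j] these rows reach only [l_j], as [Theta_(j-1)] meets [V_(j-1)] only in [E_(j-1)];
   [w] was chosen to cancel that contribution. *)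
have z_X : vrestr (A *m z) (X D j) = 0.
  transitivity (blk A (X D j) (X D j) *m vrestr w (X D j)
    + blk A (X D j) (lset D j) *m vrestr e (lset D j)); last first.
    by rewrite -hw mulmxN mulKVmx // addNr.
  rewrite !blk_vrestr -vrestrD -mulmxDr.
  apply: eq_vrestr => i Xi; apply: eq_mulmx_coupled => k Aik.
  rewrite zE mxE !maskE; have := coupled_pos Aik.
  move: Xi; rewrite !in_X => Xi cp.
  have eE : k \in lset D j -> pos k = j.-1.*2 by apply: in_E.
  case: ifP => Xk.
    by rewrite (_ : (k \in lset D j) = false) ?addr0 //; lia.
  rewrite add0r in_W //; congr (_ *+ _).
  case: (boolP (k \in lset D j)) eE => [_ /(_ isT)|nE _]; first lia.
  suff : pos k <> j.-1.*2 by lia.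
  move=> pk; move/negP: nE; apply.
  by apply: coupled_E (or_introl Aik) _ pk; lia.
(* By the choice of [w], the term of [eq_l] with the inverse is [A[l_j,X_j] w[X_j]]. *)
have z_l : vrestr (A *m z) (lset D j) = 0.
  rewrite -eq_l mulmxBl -!mulmxA addrAC -mulmxN hw !blk_vrestr -!vrestrD.
  rewrite -!mulmxDr; apply: eq_vrestr => i Ei.
  apply: eq_mulmx_coupled => k Aik.
  rewrite /z mxE [RHS]mxE addrC; congr (_ + _).
  rewrite !mxE -mulrnDr; congr (_ *+ _).
  have pi := in_E Ei; have := coupled_pos Aik; rewrite pi => cp.
  have eE : k \in E D j.-1 -> pos k = j.-1.*2 by apply: in_E.
  have eF : k \in F D j -> pos k = j.*2 by apply: in_F.
  rewrite in_W // in_N // /lset; case: (k \in E D j.-1) eE => [/(_ isT)|_];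
    case: (k \in F D j) eF => [/(_ isT)|_]; lia.
have z_N : vrestr (A *m z) (N D j) = 0.
  rewrite -eq_N blk_vrestr; apply: eq_vrestr => i Ni.
  apply: eq_mulmx_coupled => k Aik; rewrite zE mxE.
  have := coupled_N j0 Ni Aik; rewrite in_W // in_X => Wk.
  by rewrite ifF //; lia.
have z_X' : vrestr (A *m z) (X D j.+1) = 0.
  rewrite -(vrestr0 _ (X D j.+1)); apply: eq_vrestr => i.
  rewrite in_X [RHS]mxE => Xi.
  have zero Y : vrestr (A *m z) Y = 0 -> i \in Y -> (A *m z) i 0 = 0.
    rewrite -(vrestr0 _ Y) => /vrestr_inj_in h /h ->.
    by rewrite mxE.
  have [/(zero _ z_X)//|nX] := boolP (i \in X D j).
  have [/(zero _ z_l)//|nl] := boolP (i \in lset D j).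
  (* The rest of [X_(j+1)] lies in [N_j], since [r_j] sits beyond it, at position [2j]. *)
  apply: zero z_N _; rewrite in_N // nl /=; apply/andP; split.
    by apply/negP => /in_F; lia.
  by move: nX; rewrite in_X; lia.
(* Outside [X_(j+1)] its rows reach only [E_j], which is [l_(j+1)], and there [z] equals [e]. *)
have balance : blk A (X D j.+1) (X D j.+1) *m vrestr z (X D j.+1)
    + blk A (X D j.+1) (lset D j.+1) *m vrestr e (lset D j.+1) = 0.
  rewrite -z_X' !blk_vrestr -vrestrD -mulmxDr.
  apply: eq_vrestr => i; rewrite in_X => Xi.
  apply: eq_mulmx_coupled => k Aik; rewrite [LHS]mxE !maskE in_X.
  have cp := coupled_pos Aik.
  have eE : k \in lset D j.+1 -> pos k = j.*2 by apply: in_E.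
  case: ltnP => Xk.
    by rewrite (_ : (k \in lset D j.+1) = false) ?addr0 //; lia.
  have pk : pos k = j.*2 by lia.
  rewrite zE in_X in_W // (coupled_E (or_introl Aik) _ pk); last lia.
  by rewrite ifF; [rewrite add0r; congr (_ *+ _)|]; lia.
rewrite /left_residual !lrestr_vrestr ?Theta_sub_W ?lset_sub_W_pred //.
rewrite -!mulmxA; move/eqP: balance; rewrite addrC addr_eq0 => /eqP ->.
(* This leaves [A[l_(j+1),Theta_j] e - A[l_(j+1),X_(j+1)] z], which vanishes: the rows of [l_(j+1)]
   meet [X_(j+1)] only in [Theta_j], where [z] equals [e]. *)
rewrite !mulmxN mulKmx //; apply/eqP; rewrite subr_eq0; apply/eqP.
rewrite !blk_vrestr; apply: eq_vrestr => i Ei.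
apply: eq_mulmx_coupled => k Aik; rewrite !maskE.
have pi := in_E Ei; have := coupled_pos Aik; rewrite pi /= => cp.
rewrite in_X in_Theta zE in_X in_W //.
have [pk|pk] := eqVneq; last first.
  by rewrite (_ : ((pos k).+2 < j.+1.*2)%N = false) ?mulr0n //; lia.
rewrite ifF; last lia.
rewrite (_ : ((pos k).+2 < _)%N); last lia.
by rewrite (_ : (_ <= _ <= _)%N); last lia.
Qed.

Lemma card0_mx_eq m (M M' : 'M[K]_m) : m = 0%N -> M = M'.
Proof.
by move=> m0; apply/matrixP => i; have := ltn_ord i; rewrite [X in (_ < X)%N]m0.
Qed.

(** * Subproblems with exact left transmission *)

Section Sweeps.
Variable S : splitting K D.
Hypothesis hS : is_splitting A S.

(** Consistency for any transmission matrices: the [P] terms agree on both sides, and the splitting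
    with the row identities of [A] balances the [Q] terms. *)
Lemma solution_subproblem T u j : (0 < j <= nsub D)%N ->
  subproblem A S T (A *m u)
    (vrestr u (W D j.-1)) (vrestr u (W D j.+1)) (vrestr u (W D j)).
Proof.
move=> hj; have /andP[j0 _] := hj; have [Sl Sr] := hS hj.
rewrite /subproblem.
rewrite !lrestr_vrestr ?lset_sub_W ?lset_sub_W_pred ?rset_sub_W
  ?rset_sub_W_succ ?Theta_sub_W ?N_sub_W //.
split; last 1 first.
- rewrite rset_row // addrK Sr !mulmxDl mulNmx !mulmxDr !mulmxA -!addrA.
  by congr (_ + (_ + _)); rewrite addrCA subrr addr0.
- rewrite lset_row // addrK Sl !mulmxDl mulNmx !mulmxDr !mulmxA -!addrA.
  congr (_ + _).
  by rewrite [RHS]addrCA [X in _ = _ + X]addrCA subrr addr0 addrC.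
- by rewrite N_row.
Qed.

(* For [j = 1], not covered by [exact_left], both index sets are empty. *)
Lemma exact_left_first T j : exact_left A S T -> (0 < j <= nsub D)%N ->
  [/\ blk A (X D j) (X D j) \in unitmx,
      Ql T j = 1%:M
    & Pl T j = Al_ext S j - blk A (lset D j) (X D j)
        *m invmx (blk A (X D j) (X D j)) *m blk A (X D j) (lset D j)].
Proof.
move=> hT hj; have [j1|j1] := ltnP 1 j; first by apply: hT; lia.
have {hj j1} -> : j = 1%N by lia.
have l0 : #|lset D 1| = 0%N.
  by have [_ E0 _] := wf_V_out hD (j := 0) isT; rewrite /lset E0 cards0.
have X0 : #|X D 1| = 0%N by apply: eq_card0 => i; rewrite in_X.
split; [|exact: card0_mx_eq..].
by rewrite (card0_mx_eq (blk _ _ _) 1%:M X0) unitmx1.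
Qed.

(** With [Ql = I], [Al_ext] cancels in [Pl - Ql *m Al_ext], so left data with equal residuals are
    interchangeable. *)
Lemma subproblem_left_residual T f j a a' b v : exact_left A S T ->
  (0 < j <= nsub D)%N -> left_residual a = left_residual a' ->
  subproblem A S T f a b v -> @subproblem _ _ A _ S T f j a' b v.
Proof.
move=> hT hj eq_a [h1 h2 h3]; split=> //; rewrite h1.
have [_ -> ->] := exact_left_first hT hj.
rewrite !mul1mx (addrAC (Al_ext S j)) subrr sub0r !mulNmx -!addrA -!opprD.
by congr (_ - _).
Qed.

Lemma sweep_left_residual T u j a b v : exact_left A S T ->
  (0 < j < nsub D)%N -> left_residual a = left_residual (vrestr u (W D j.-1)) ->
  @subproblem _ _ A _ S T (A *m u) j a b v ->
  left_residual (v : 'cV_#|W D j.+1.-1|)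
    = left_residual (vrestr u (W D j) : 'cV_#|W D j.+1.-1|).
Proof.
move=> hT hj eq_a sub_v.
have hj1 : (0 < j <= nsub D)%N by lia.
have j0 : (0 < j)%N by lia.
have hj' : (0 < j.+1 <= nsub D)%N by lia.
have [uX Q1 P1] := exact_left_first hT hj1.
have [uX' _ _] := exact_left_first hT hj'.
(* With exact left data in place of [a], [v] and [u[W_j]] satisfy the same left and interior
   equations, so their difference satisfies the homogeneous ones. *)
have [v1 v2 _] := subproblem_left_residual hT hj1 eq_a sub_v.
have [u1 u2 _] := solution_subproblem T u hj1.
have [e he] := vrestr_surj (v - vrestr u (W D j)).
apply/eqP; rewrite -subr_eq0 -left_residualB he; apply/eqP.
apply: left_residual_eq0 => //; last first.
  by rewrite -he mulmxBr v2 u2 subrr.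
have [Sl _] := hS hj1.
rewrite -(lrestr_vrestr e (lset_sub_W j)) -(lrestr_vrestr e (N_sub_W j)) -he.
rewrite !lrestrB !mulmxBr addrACA -opprD.
rewrite (_ : _ - _ *m _ = Ql T j *m Al_int S j + Pl T j); last first.
  by rewrite Q1 P1 mul1mx Sl addrA.
rewrite -(mul1mx (blk A (lset D j) (N D j))) -Q1 v1 u1 subrr //.
Qed.

End Sweeps.
End WithPosition.

Lemma W_out j : ~~ (0 < j <= nsub D)%N -> W D j = set0.
Proof.
move=> hj; have out k : ~~ (0 < k < nsub D)%N -> V D k = set0.
  by case/(wf_V_out hD).
by rewrite /W (wf_Theta_out hD hj) !out ?setU0 //; lia.
Qed.

Lemma W_out_eq j (x y : 'cV[K]_#|W D j|) : ~~ (0 < j <= nsub D)%N -> x = y.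
Proof.
move=> hj; apply/colP => i; have := ltn_ord i.
by rewrite [X in (_ < X)%N](_ : _ = 0%N) // W_out ?cards0.
Qed.

(** * Exactness of one double sweep and the iteration matrix *)

Section Step.
Variables (S : splitting K D) (Tf Tb : transmission K D) (u : 'cV[K]_n).
Hypothesis hS : is_splitting A S.
Hypothesis hTf : exact_left A S Tf.
Hypothesis hTb : exact_left A S Tb.
Hypothesis hsolf : forall j, (0 < j < nsub D)%N ->
  uniquely_solvable_subproblem A S Tf (A *m u) j.
Hypothesis hsolb : forall j, (0 < j <= nsub D)%N ->
  uniquely_solvable_subproblem A S Tb (A *m u) j.

Lemma dosm_step_exact uold unew : dosm_step A S Tf Tb (A *m u) uold unew ->
  forall j, (0 < j <= nsub D)%N -> unew j = vrestr u (W D j).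
Proof.
move=> [uhalf [fwd bwd]]; have [pos posP] := position_exists.
have left_exact j : (j < nsub D)%N ->
    left_residual (uhalf j : 'cV_#|W D j.+1.-1|)
    = left_residual (vrestr u (W D j) : 'cV_#|W D j.+1.-1|).
  elim: j => [|j IHj] hj.
    (* [W_0] is empty, so all vectors on it agree. *)
    by congr left_residual; apply: W_out_eq.
  apply: (sweep_left_residual posP hS hTf) (fwd j.+1 _) => //.
  by apply: IHj; lia.
(* Induction from the right: [k = 0] is the fictitious subdomain [J + 1], with empty [W]. *)
suff bwd_exact k j : (j + k)%N = (nsub D).+1 -> unew j = vrestr u (W D j).
  by move=> j hj; apply: (bwd_exact ((nsub D).+1 - j)%N); lia.
elim: k j => [|k IHk] [|j] hj; try by apply: W_out_eq; lia.
have hj1 : (0 < j.+1 <= nsub D)%N by lia.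
have := bwd j.+1 hj1; rewrite IHk; last lia.
move/(subproblem_left_residual posP hTb hj1 (left_exact j _)) => sub.
(* Both [unew j.+1] and [u[W_(j+1)]] solve the subproblem with exact data on both sides. *)
have [x [_ x_unique]] :=
  hsolb hj1 (vrestr u (W D j)) (vrestr u (W D j.+2)).
rewrite -(x_unique (unew j.+1)); last by apply: sub; lia.
exact/x_unique/(solution_subproblem posP hS).
Qed.

(** Serves the uniqueness of the iteration matrix, which is constrained only by steps that exist. *)
Lemma dosm_step_exists uold :
  exists unew, dosm_step A S Tf Tb (A *m u) uold unew.
Proof.
have solf j a b : {v | (0 < j < nsub D)%N ->
    @subproblem _ _ A _ S Tf (A *m u) j a b v}.
  apply: cid; case: (boolP (0 < j < nsub D)%N) => [hj|_]; last by exists 0.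
  by have [v [hv _]] := hsolf hj a b; exists v.
have solb j a b : {v | (0 < j <= nsub D)%N ->
    @subproblem _ _ A _ S Tb (A *m u) j a b v}.
  apply: cid; case: (boolP (0 < j <= nsub D)%N) => [hj|_]; last by exists 0.
  by have [v [hv _]] := hsolb hj a b; exists v.
pose uhalf := fix h j : 'cV[K]_#|W D j| :=
  if j is j'.+1 then sval (solf j'.+1 (h j') (uold j'.+2)) else 0.
(* At [k = J + 1 - j], [k] counts the subdomains from [j] to [J], so the recursion is structural
   although [j] increases; the value at [J + 1] is 0. *)
pose g := fix g k j : 'cV[K]_#|W D j| :=
  if k is k'.+1 then sval (solb j (uhalf j.-1) (g k' j.+1)) else 0.
exists (fun j => g ((nsub D).+1 - j)%N j), uhalf; split=> [[//|j] hj|j hj].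
  exact: (svalP (solf j.+1 (uhalf j) (uold j.+2))).
rewrite subSS subSn; last by case/andP: hj.
exact: (svalP (solb j (uhalf j.-1) (g (nsub D - j)%N j.+1))).
Qed.

Lemma error_surj (x : 'cV[K]_(\sum_(j < nsub D) #|W D j.+1|)) :
  exists v, error u v = x.
Proof.
(* Solves [u[W_j] - v_j = x_j]; blocks of [x] are numbered from 0, subdomains from 1, and [v] is 0
   out of range. *)
pose v j : 'cV[K]_#|W D j| := if j is j'.+1 then
  if boolP (j' < nsub D)%N is AltTrue h
  then vrestr u (W D j'.+1) - submxcol x (Ordinal h) else 0 else 0.
exists v; rewrite -[RHS]submxcolK; apply: eq_mxcol => -[i hi] /=.
case: {-}_ / boolP => [h|]; last by rewrite hi.
by rewrite subKr (bool_irrelevance h hi).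
Qed.

Lemma iteration_matrix0 :
  unique (is_iteration_matrix A S Tf Tb (A *m u) u) 0.
Proof.
have error0 uold unew :
    dosm_step A S Tf Tb (A *m u) uold unew -> error u unew = 0.
  move=> /dosm_step_exact h; rewrite -[RHS]submxcolK.
  apply: eq_mxcol => i; rewrite h ?subrr ?ltn_ord //.
  by apply/matrixP => a b; rewrite !mxE.
split=> [uold unew /error0 ->|M hM]; first by rewrite mul0mx.
apply/esym/matrixP => i j.
(* A start whose error is the [j]-th unit vector has column [j] of [M] as its new error. *)
have [uold hold] := error_surj (delta_mx j 0).
have [unew hstep] := dosm_step_exists uold.
have := hM _ _ hstep; rewrite (error0 _ _ hstep) hold -colE => /colP/(_ i).
by rewrite !mxE.
Qed.

End Step.

(** Nilpotency of degree one includes [M ^+ 0 != 0], which fails for a matrix of size 0; an element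
    of [Theta_1] excludes this. *)
Lemma sum_card_W_gt0 : (0 < \sum_(j < nsub D) #|W D j.+1|)%N.
Proof.
have hJ := wf_nsub hD.
rewrite lt0n sum_nat_eq0 negb_forall; apply/existsP; exists (Ordinal hJ) => /=.
have [//|i Ti] := set0Pn _ (wf_Theta hD (j := 1) _).
by rewrite -lt0n; apply/card_gt0P; exists i; rewrite (subsetP (Theta_sub_W 1)).
Qed.

End Positions.

Lemma nilpotent_of_degree0 (K : fieldType) m :
  (0 < m)%N -> nilpotent_of_degree (0 : 'M[K]_m) 1.
Proof.
move=> m0; split=> [|[|//] _]; first by rewrite expr1.
rewrite expr0; apply/eqP => /matrixP/(_ (Ordinal m0) (Ordinal m0)).
by rewrite !mxE eqxx => /eqP; rewrite oner_eq0.
Qed.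

Theorem theorem6p2 (R : realType) (n : nat) (A : 'M[complex R]_n)
    (D : decomposition n) (As : splitting (complex R) D)
    (Tf Tb : transmission (complex R) D) (f u : 'cV[complex R]_n)
    (hD : wf_decomposition A D)
    (hS : is_splitting A As)
    (hTf : exact_left A As Tf)
    (hTb : exact_left A As Tb)
    (hA : exists! v : 'cV[complex R]_n, A *m v = f)
    (hsolf : forall j : nat, (0 < j < nsub D)%N ->
       uniquely_solvable_subproblem A As Tf f j)
    (hsolb : forall j : nat, (0 < j <= nsub D)%N ->
       uniquely_solvable_subproblem A As Tb f j)
    (hu : A *m u = f) :
  (forall us : nat -> locals (complex R) D,
     dosm A As Tf Tb f us ->
     forall j : nat, (0 < j <= nsub D)%N -> us 1%N j = vrestr u (W D j)) /\
  (exists M : 'M[complex R]_(\sum_(j < nsub D) #|W D j.+1|),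
     unique (is_iteration_matrix A As Tf Tb f u) M /\
     nilpotent_of_degree M 1).
Proof.
subst f; split=> [us /(_ 0%N)|]; first exact: dosm_step_exact.
exists 0; split; first exact: iteration_matrix0.
exact/nilpotent_of_degree0/(sum_card_W_gt0 hD).
Qed.
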